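(* Let $\chi\in(0,1)$, $\beta\in(0,\infty)$ and $\eta\in\Phi_k$. The problem $$\min_{f\in\mathcal{H}(k_\eta)}\ \sum_{i=m+1}^n\big(f(\bar z_i)-\bar y_i\big)^2+\beta|f|_{k_\eta}^2\quad\text{subject to}\quad m|f|_{k_\eta}^2\le\chi$$ is solvable, and a solution is given by $$f=\sum_{i=m+1}^n c_i\,k_\eta(\cdot,\bar z_i),\qquad c=(c_{m+1},\dots,c_n)=\big(K_\eta+\max(\bar\alpha,\beta)I_{n-m}\big)^{-1}\bar y,$$ in which $\bar\alpha\in[0,\infty)$ is such that $\gamma(\bar\alpha)=0$, if such an $\bar\alpha$ exists, and $\bar\alpha=0$ otherwise, where $\gamma:(0,\infty)\to\mathbb{R}$ is $$\gamma(\alpha)=m\,\bar y^\top(K_\eta+\alpha I_{n-m})^{-1}K_\eta(K_\eta+\alpha I_{n-m})^{-1}\bar y-\chi .$$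
   Context: Let $m\in\mathbb{N}$ and $n\in\mathbb{N}$ with $n>m$. A kernel structure $k$ consists of a parameter set $\Phi_k\subseteq\mathbb{R}^{n_\eta}$ and, for each $\eta\in\Phi_k$, a symmetric positive semidefinite kernel $k_\eta:\mathbb{R}^{2m+1}\times\mathbb{R}^{2m+1}\to\mathbb{R}$; $\mathcal{H}(k_\eta)$ is the reproducing kernel Hilbert space of $k_\eta$, with norm $|\cdot|_{k_\eta}$. A dataset of real numbers $(\bar u_i,\bar y_i)_{i=1}^n$ is given; for $t\in\{m+1,\dots,n\}$, $\bar z_t=(\bar y_{t-m},\dots,\bar y_{t-1},\bar u_{t-m},\dots,\bar u_t)\in\mathbb{R}^{2m+1}$. $K_\eta\in\mathbb{R}^{(n-m)\times(n-m)}$ is the matrix with $(i,j)$ entry $k_\eta(\bar z_{m+i},\bar z_{m+j})$, and $\bar y=(\bar y_{m+1},\dots,\bar y_n)\in\mathbb{R}^{n-m}$ as a column vector. $I_{n-m}$ is the identity matrix. Since $\gamma$ is defined on $(0,\infty)$, the root $\bar\alpha$ of $\gamma$ is sought in that domain. *)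

(* Defs.v *)
From mathcomp Require Export all_boot all_order all_algebra.
From mathcomp Require Export boolp classical_sets functions reals topology.
From mathcomp Require Export normedtype.
Export Order.TTheory GRing.Theory Num.Theory.
Export numFieldNormedType.Exports.

Set Implicit Arguments.
Unset Strict Implicit.
Unset Printing Implicit Defensive.

#[export] Set Implicit Arguments.
#[export] Unset Strict Implicit.
#[export] Unset Printing Implicit Defensive.

Local Open Scope classical_set_scope.
Local Open Scope ring_scope.

Definition is_kernel (R : realType) (X : Type) (k : X -> X -> R) : Prop :=
  (forall x y, k x y = k y x) /\
  (forall (N : nat) (x : 'I_N -> X) (a : 'I_N -> R),
     0 <= \sum_(i < N) \sum_(j < N) a i * a j * k (x i) (x j)).

Definition dot_norm (R : realType) (X : Type)
    (dot : (X -> R) -> (X -> R) -> R) (f : X -> R) : R :=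
  Num.sqrt (dot f f).

(* [H], a set of functions, is a real Hilbert space for the pointwise
   operations and the inner product [dot].  The values of [dot] outside [H]
   are irrelevant. *)
Record is_hilbert (R : realType) (X : Type) (H : set (X -> R))
    (dot : (X -> R) -> (X -> R) -> R) : Prop := IsHilbert {
  hilbert_zero : H (fun=> 0);
  hilbert_linear : forall (a : R) f g, H f -> H g -> H (a \*o f \+ g);
  hilbert_dotC : forall f g, H f -> H g -> dot f g = dot g f;
  hilbert_dotPl : forall (a : R) f g h, H f -> H g -> H h ->
    dot (a \*o f \+ g) h = a * dot f h + dot g h;
  hilbert_dot_ge0 : forall f, H f -> 0 <= dot f f;
  hilbert_dot_eq0 : forall f, H f -> dot f f = 0 -> f = (fun=> 0);
  hilbert_complete : forall F : nat -> X -> R, (forall p, H (F p)) ->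
    (forall e : R, 0 < e ->
       \forall p & q \near \oo, dot_norm dot (F p \- F q) < e) ->
    exists2 f, H f & (fun p => dot_norm dot (F p \- f)) @ \oo --> (0 : R)
}.

(* A kernel has exactly one reproducing kernel Hilbert space (Moore-Aronszajn):
   for [H : rkhs k], the set [rkhs_set H] and the restriction of [rkhs_dot H]
   to it are determined by [k]. *)
Record rkhs (R : realType) (X : Type) (k : X -> X -> R) : Type := Rkhs {
  rkhs_set : set (X -> R);
  rkhs_dot : (X -> R) -> (X -> R) -> R;
  rkhs_hilbert : is_hilbert rkhs_set rkhs_dot;
  rkhs_section : forall x, rkhs_set (k^~ x);
  rkhs_reproducing : forall f x, rkhs_set f -> rkhs_dot f (k^~ x) = f x
}.

Definition rkhs_norm (R : realType) (X : Type) (k : X -> X -> R) (H : rkhs k)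
    (f : X -> R) : R := dot_norm (rkhs_dot H) f.

(* The values of [ks_fun] at parameters outside [ks_param] are irrelevant. *)
Record kernel_structure (R : realType) (d p : nat) : Type := KernelStructure {
  ks_param : set 'rV[R]_p;
  ks_fun : 'rV[R]_p -> 'rV[R]_d -> 'rV[R]_d -> R;
  ks_kernel : forall eta, ks_param eta -> is_kernel (ks_fun eta)
}.

Definition is_minimizer (R : realType) (T : Type) (J : T -> R) (A : set T)
    (f : T) : Prop :=
  A f /\ forall g, A g -> J f <= J g.

(* Data are functions [u y : nat -> R] of which only the values at 1, ..., n
   are used; [m + m.+1] is the dimension 2m+1.  Matrix indices start at 0, so
   the index [i : 'I_(n - m)] stands for the time m + i + 1. *)
Section Problem.
Variables (R : realType) (m n : nat) (u y : nat -> R).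

(* (y_{t-m}, ..., y_{t-1}, u_{t-m}, ..., u_t) *)
Definition regressor (t : nat) : 'rV[R]_(m + m.+1) :=
  row_mx (\row_(j < m) y (t - m + j)%N) (\row_(j < m.+1) u (t - m + j)%N).

Definition targets : 'cV[R]_(n - m) := \col_i y (m + i.+1)%N.

Variable k : 'rV[R]_(m + m.+1) -> 'rV[R]_(m + m.+1) -> R.

Definition gram : 'M[R]_(n - m) :=
  \matrix_(i, j) k (regressor (m + i.+1)%N) (regressor (m + j.+1)%N).

Definition objective (H : rkhs k) (beta : R)
    (f : 'rV[R]_(m + m.+1) -> R) : R :=
  \sum_(m.+1 <= t < n.+1) (f (regressor t) - y t) ^+ 2
    + beta * rkhs_norm H f ^+ 2.

Definition feasible (H : rkhs k) (chi : R) : set ('rV[R]_(m + m.+1) -> R) :=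
  [set f | rkhs_set H f /\ m%:R * rkhs_norm H f ^+ 2 <= chi].

(* Only meaningful for [0 < alpha]: there [gram + alpha%:M] is invertible. *)
Definition gamma (chi alpha : R) : R :=
  m%:R * (targets^T *m invmx (gram + alpha%:M) *m gram
            *m invmx (gram + alpha%:M) *m targets) 0 0 - chi.

Definition is_alpha_bar (chi alpha : R) : Prop :=
  (0 < alpha /\ gamma chi alpha = 0) \/
  ((forall a, 0 < a -> gamma chi a <> 0) /\ alpha = 0).

Definition coeffs (lambda : R) : 'cV[R]_(n - m) :=
  invmx (gram + lambda%:M) *m targets.

Definition candidate (lambda : R) (x : 'rV[R]_(m + m.+1)) : R :=
  \sum_(i < n - m) coeffs lambda i 0 * k x (regressor (m + i.+1)%N).

End Problem.

(* Main.v *)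
Require Import Defs.
From mathcomp Require Import ring lra.

(* The candidate f_l = sum_i c_i k(., z_i), c = (K + l I)^-1 y, minimizes
   L_l(f) = sum_i (f(z_i) - y_i)^2 + l |f|^2 over the whole space: the
   first-order term of L_l(f_l + h) - L_l(f_l) vanishes because K c - y = - l c
   and <f_l, h> = sum_i c_i h(z_i).  Comparing the minimal values of L_l and of
   L_l' gives that |f_l| is nonincreasing in l, and comparing with f = 0 gives
   l |f_l|^2 <= |y|^2.  Moreover gamma(a) = m |f_a|^2 - chi.  If gamma has a
   root a >= beta, it is a Lagrange multiplier: the constraint is active at f_a
   and J = L_a - (a - beta) |.|^2.  If it has a root a < beta, monotonicity
   makes f_beta feasible.  If it has no root, then gamma(beta) <= 0, since
   det(K + a I)^2 gamma(a) is a polynomial in a, nonpositive for large a, to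
   which the intermediate value theorem applies. *)

Local Open Scope ring_scope.

(** * Calculus in a Hilbert space of functions *)

Section Hilbert.
Variables (R : realType) (X : Type) (S : set (X -> R)).
Variables (dot : (X -> R) -> (X -> R) -> R) (hS : is_hilbert S dot).

Lemma hilbert_sum (I : Type) (r : seq I) (c : I -> R) (v : I -> X -> R) :
  (forall i, S (v i)) -> S (fun x => \sum_(i <- r) c i * v i x).
Proof.
move=> Sv; elim: r => [|i r IHr].
  by under eq_fun do rewrite big_nil; exact: hilbert_zero hS.
under eq_fun do rewrite big_cons.
exact: (hilbert_linear hS (c i) (Sv i) IHr).
Qed.

Lemma hilbert_dot0l f : S f -> dot (fun=> 0) f = 0.
Proof.
move=> Sf; have S0 := hilbert_zero hS.
have := hilbert_dotPl hS 1 S0 S0 Sf.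
have -> : 1 \*o (fun=> 0) \+ (fun=> 0) = (fun=> 0) :> (X -> R).
  by apply: funext => x /=; rewrite mulr0 addr0.
by lra.
Qed.

Lemma hilbert_dot_suml (I : Type) (r : seq I) (c : I -> R) (v : I -> X -> R)
    (f : X -> R) :
  (forall i, S (v i)) -> S f ->
  dot (fun x => \sum_(i <- r) c i * v i x) f = \sum_(i <- r) c i * dot (v i) f.
Proof.
move=> Sv Sf; elim: r => [|i r IHr].
  under eq_fun do rewrite big_nil.
  by rewrite big_nil hilbert_dot0l.
under eq_fun do rewrite big_cons.
rewrite big_cons -IHr.
exact: (hilbert_dotPl hS (c i) (Sv i) (hilbert_sum r c Sv) Sf).
Qed.

Lemma hilbert_dot_sqrD f h : S f -> S h ->
  dot (1 \*o h \+ f) (1 \*o h \+ f) = dot f f + 2 * dot f h + dot h h.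
Proof.
move=> Sf Sh; have Sg := hilbert_linear hS 1 Sh Sf.
rewrite (hilbert_dotPl hS) // (hilbert_dotC hS Sh Sg) (hilbert_dotC hS Sf Sg).
rewrite !(hilbert_dotPl hS) // (hilbert_dotC hS Sh Sf); ring.
Qed.

(** The factor 1 puts the perturbation in the form that [hilbert_linear] and [hilbert_dotPl]
    accept. *)
Lemma hilbert_sub f g : S f -> S g -> exists2 h, S h & g = 1 \*o h \+ f.
Proof.
move=> Sf Sg; exists (-1 \*o f \+ g); first exact: hilbert_linear hS _ _ _ Sf Sg.
by apply: funext => x /=; ring.
Qed.

Lemma sqr_dot_norm f : S f -> dot_norm dot f ^+ 2 = dot f f.
Proof. by move=> Sf; rewrite sqr_sqrtr // (hilbert_dot_ge0 hS). Qed.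

End Hilbert.

(** * The shifted Gram matrix and its resolvent *)

Section GramMatrix.
Variables (R : realType) (N : nat) (K : 'M[R]_N).
Hypothesis K_sym : K^T = K.
Hypothesis K_psd : forall v : 'rV[R]_N, 0 <= (v *m K *m v^T) 0 0.

Lemma row_sqr_eq0 (v : 'rV[R]_N) : (v *m v^T) 0 0 <= 0 -> v = 0.
Proof.
rewrite mxE; under eq_bigr do rewrite mxE -expr2.
move=> v_le0; apply/rowP => i; rewrite mxE.
have v_ge0 : 0 <= \sum_j v 0 j ^+ 2 by apply: sumr_ge0 => j _; exact: sqr_ge0.
have /eqP : \sum_j v 0 j ^+ 2 = 0 by apply/eqP; rewrite eq_le v_le0.
rewrite psumr_eq0 => [/allP/(_ i (mem_index_enum i))|j _]; last exact: sqr_ge0.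
by rewrite sqrf_eq0 => /eqP.
Qed.

(** A left null vector v has v K = - l v, hence v K v^T = - l |v|^2, which is nonnegative only for v
    = 0. *)
Lemma psd_shift_unitmx (l : R) : 0 < l -> K + l%:M \in unitmx.
Proof.
move=> l_gt0; rewrite unitmxE unitfE; apply/det0P => -[v v_neq0].
rewrite mulmxDr mul_mx_scalar => vK.
move/eqP: v_neq0; apply; apply: row_sqr_eq0.
have := K_psd v; have -> : v *m K = - (l *: v) by apply/eqP; rewrite -addr_eq0 vK.
by rewrite mulNmx -scalemxAl mxE mxE oppr_ge0 pmulr_rle0.
Qed.

Lemma resolvent_form (w : 'cV[R]_N) (l : R) :
  w^T *m invmx (K + l%:M) *m K *m invmx (K + l%:M) *m w
  = (invmx (K + l%:M) *m w)^T *m K *m (invmx (K + l%:M) *m w).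
Proof.
by rewrite trmx_mul trmx_inv linearD /= K_sym tr_scalar_mx !mulmxA.
Qed.

(** By Cramer's rule each inverse is an adjugate over the determinant, so the squared determinant
    clears both denominators. The polynomial is built from the matrix K + X I over [{poly R}], which
    evaluation at l, a ring morphism, sends to K + l I. *)
Lemma resolvent_form_poly (w : 'cV[R]_N) (a b : R) :
  exists q : {poly R}, forall l, 0 < l ->
    q.[l] = \det (K + l%:M) ^+ 2
      * (a * (w^T *m invmx (K + l%:M) *m K *m invmx (K + l%:M) *m w) 0 0 - b).
Proof.
pose Kp := map_mx polyC K; pose wp := map_mx polyC w; pose A := Kp + 'X%:M.
exists (a%:P * (wp^T *m \adj A *m Kp *m \adj A *m wp) 0 0
        - b%:P * \det A ^+ 2) => l l_gt0.
have constK p q (M : 'M[R]_(p, q)) : map_mx (horner_eval l) (map_mx polyC M) = M.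
  by apply/matrixP => i j; rewrite !mxE /= /horner_eval hornerC.
have evA : map_mx (horner_eval l) A = K + l%:M.
  by rewrite map_mxD constK map_scalar_mx /= /horner_eval hornerX.
have evdet : (\det A).[l] = \det (K + l%:M) by rewrite -evA det_map_mx.
rewrite !hornerE evdet.
have -> : ((wp^T *m \adj A *m Kp *m \adj A *m wp) 0 0).[l] =
    (w^T *m \adj (K + l%:M) *m K *m \adj (K + l%:M) *m w) 0 0.
  transitivity (map_mx (horner_eval l) (wp^T *m \adj A *m Kp *m \adj A *m wp) 0 0).
    by rewrite [RHS]mxE.
  by rewrite !map_mxM map_trmx map_mx_adj evA !constK.
have uK := psd_shift_unitmx l_gt0.
rewrite /invmx uK.
have := uK; rewrite unitmxE unitfE => det_neq0.
rewrite -scalemxAr -scalemxAl -scalemxAr -!scalemxAl.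
set M := w^T *m _ *m _ *m _ *m _; rewrite [in RHS]mxE [in RHS]mxE /=.
field.
exact: det_neq0.
Qed.

End GramMatrix.

(** * Regularized least squares in the reproducing kernel space *)

Section Ridge.
Variables (R : realType) (X : Type) (k : X -> X -> R) (hk : is_kernel k).
Variables (H : rkhs k) (N : nat) (z : 'I_N -> X) (w : 'cV[R]_N).

Let K : 'M[R]_N := \matrix_(i, j) k (z i) (z j).
Let S := rkhs_set H.
Let dot := rkhs_dot H.
Let hS := rkhs_hilbert H.
Let c l : 'cV[R]_N := invmx (K + l%:M) *m w.
Let f l (x : X) : R := \sum_(i < N) c l i 0 * k x (z i).
Let L l (g : X -> R) : R := \sum_(i < N) (g (z i) - w i 0) ^+ 2 + l * dot g g.

Lemma kernel_matrix_sym : K^T = K.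
Proof. by apply/matrixP => i j; rewrite !mxE hk.1. Qed.

Lemma kernel_matrix_psd (v : 'rV[R]_N) : 0 <= (v *m K *m v^T) 0 0.
Proof.
have := hk.2 N z (v 0); congr (_ <= _).
rewrite exchange_big /= mxE; apply: eq_bigr => j _.
rewrite !mxE mulr_suml; apply: eq_bigr => i _.
by rewrite !mxE mulrAC.
Qed.

Lemma ridge_in l : S (f l).
Proof.
exact: (hilbert_sum hS _ _ (fun i => rkhs_section H (z i))).
Qed.

Lemma ridge_dot l h : S h -> dot (f l) h = \sum_i c l i 0 * h (z i).
Proof.
move=> Sh; rewrite /dot.
rewrite (hilbert_dot_suml hS _ _ (fun i => rkhs_section H (z i)) Sh).
apply: eq_bigr => i _.
by rewrite (hilbert_dotC hS (rkhs_section H _) Sh) rkhs_reproducing.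
Qed.

Lemma ridge_at l i : f l (z i) = (K *m c l) i 0.
Proof. by rewrite [RHS]mxE; apply: eq_bigr => j _; rewrite [K _ _]mxE mulrC. Qed.

(** This is row i of the normal equation (K + l I) c = w. *)
Lemma ridge_residual l i : 0 < l -> f l (z i) - w i 0 = - (l * c l i 0).
Proof.
move=> l_gt0.
have : (K + l%:M) *m c l = w.
  by rewrite mulKVmx // (psd_shift_unitmx kernel_matrix_psd).
rewrite mulmxDl mul_scalar_mx => /matrixP/(_ i 0).
rewrite mxE -ridge_at mxE => <-; ring.
Qed.

Lemma ridge_dot_self l :
  dot (f l) (f l)
  = (w^T *m invmx (K + l%:M) *m K *m invmx (K + l%:M) *m w) 0 0.
Proof.
rewrite (resolvent_form kernel_matrix_sym) -mulmxA mxE (ridge_dot _ (ridge_in _)).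
by apply: eq_bigr => i _; rewrite ridge_at [(_^T) _ _]mxE.
Qed.

Lemma ridge_min l g : 0 < l -> S g -> L l (f l) <= L l g.
Proof.
move=> l_gt0 Sg; have [h Sh ->] := hilbert_sub hS (ridge_in l) Sg.
rewrite /L /dot (hilbert_dot_sqrD hS (ridge_in l) Sh).
(* The cross terms are - 2 l c_i h(z_i); their sum cancels the cross term of l |f_l + h|^2. *)
have -> : \sum_i ((1 \*o h \+ f l) (z i) - w i 0) ^+ 2 =
    \sum_i (f l (z i) - w i 0) ^+ 2 + \sum_i h (z i) ^+ 2
    - 2 * l * dot (f l) h.
  rewrite ridge_dot // mulr_sumr -big_split -sumrB /=.
  apply: eq_bigr => i _.
  have -> : 1 * h (z i) + f l (z i) - w i 0 = h (z i) + (f l (z i) - w i 0).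
    by ring.
  by rewrite ridge_residual //; ring.
have h2_ge0 : 0 <= \sum_i h (z i) ^+ 2.
  by apply: sumr_ge0 => i _; exact: sqr_ge0.
have : 0 <= l * rkhs_dot H h h.
  by rewrite mulr_ge0 ?(hilbert_dot_ge0 hS) // ltW.
rewrite /dot; lra.
Qed.

(** Each of the two candidates is tested against the other's minimality; in the sum of the two
    inequalities the residuals cancel. *)
Lemma ridge_norm_anti l l' : 0 < l -> l <= l' ->
  dot (f l') (f l') <= dot (f l) (f l).
Proof.
move=> l_gt0; rewrite le_eqVlt => /predU1P[->//|ll'].
have := ridge_min l_gt0 (ridge_in l').
have := ridge_min (lt_trans l_gt0 ll') (ridge_in l).
rewrite /L => h1 h2.
have : 0 <= (l' - l) * (dot (f l) (f l) - dot (f l') (f l')) by lra.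
by rewrite pmulr_rge0 ?subr_gt0 // subr_ge0.
Qed.

Lemma ridge_norm_le l : 0 < l ->
  l * dot (f l) (f l) <= \sum_i w i 0 ^+ 2.
Proof.
move=> l_gt0; have := ridge_min l_gt0 (hilbert_zero hS).
rewrite /L /dot (hilbert_dot0l hS (hilbert_zero hS)) mulr0 addr0.
under [X in _ <= X]eq_bigr do rewrite sub0r sqrrN.
apply: le_trans; rewrite lerDr; apply: sumr_ge0 => i _; exact: sqr_ge0.
Qed.

Lemma ridge_norm_root (a b l : R) : 0 <= a -> 0 < b -> 0 < l ->
  b < a * dot (f l) (f l) -> exists2 l', 0 < l' & a * dot (f l') (f l') = b.
Proof.
move=> a_ge0 b_gt0 l_gt0 hl.
have [q hq] := resolvent_form_poly kernel_matrix_psd w a b.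
pose s := \sum_i w i 0 ^+ 2.
have s_ge0 : 0 <= s by apply: sumr_ge0 => i _; exact: sqr_ge0.
(* Chosen so that r b = l b + a s is at least a s, which bounds a r |f_r|^2. *)
pose r := l + a * s / b.
have lr : l <= r by rewrite lerDl divr_ge0 ?mulr_ge0 // ltW.
have r_gt0 := lt_le_trans l_gt0 lr.
have hr : a * dot (f r) (f r) <= b.
  rewrite -(ler_pM2l r_gt0) mulrCA.
  apply: (le_trans (ler_wpM2l a_ge0 (ridge_norm_le r_gt0))).
  have -> : r * b = l * b + a * s by rewrite /r; field; exact: lt0r_neq0.
  by rewrite lerDr mulr_ge0 // ltW.
have [l'] : exists2 l', l' \in `[l, r] & root (- q) l'.
  (* [poly_ivt] expects a change of sign from nonpositive to nonnegative, and q changes the other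
     way, whence - q. *)
  apply: (poly_ivt lr); rewrite !hornerN !oppr_cp0 (hq _ l_gt0) (hq _ r_gt0).
  rewrite -!ridge_dot_self; apply/andP; split.
    by apply: mulr_ge0; rewrite ?sqr_ge0 // subr_ge0 ltW.
  by apply: mulr_ge0_le0; rewrite ?sqr_ge0 // subr_le0.
rewrite in_itv /= => /andP[ll' _].
have l'_gt0 := lt_le_trans l_gt0 ll'.
rewrite rootE hornerN oppr_eq0 hq // -ridge_dot_self mulf_eq0.
have := psd_shift_unitmx kernel_matrix_psd l'_gt0.
rewrite unitmxE unitfE sqrf_eq0 => /negPf-> /=.
by rewrite subr_eq0 => /eqP ?; exists l'.
Qed.

End Ridge.

Section Reduction.
Variables (R : realType) (m n : nat) (u y : nat -> R).
Variables (k : 'rV[R]_(m + m.+1) -> 'rV[R]_(m + m.+1) -> R) (H : rkhs k).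

Lemma objectiveE beta g : rkhs_set H g ->
  objective n u y H beta g =
  \sum_(i < n - m) (g (regressor m u y (m + i.+1)%N) - targets m n y i 0) ^+ 2
  + beta * rkhs_dot H g g.
Proof.
move=> Hg; rewrite /objective /rkhs_norm (sqr_dot_norm (rkhs_hilbert H)) //.
(* Reindexing by t = i + m + 1. *)
congr (_ + _); rewrite -{1}[m.+1]add0n big_addn subSS big_mkord.
by apply: eq_bigr => i _; rewrite mxE addnC addSnnS.
Qed.

Lemma gammaE chi l : is_kernel k ->
  gamma n u y k chi l =
  m%:R * rkhs_dot H (candidate n u y k l) (candidate n u y k l) - chi.
Proof. by move=> hk; rewrite (ridge_dot_self hk H). Qed.

End Reduction.

Theorem theorem2 (R : realType) (m n : nat) (hmn : (m < n)%N)
    (p : nat) (ks : kernel_structure R (m + m.+1) p)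
    (u y : nat -> R)
    (chi beta : R) (hchi : 0 < chi < 1) (hbeta : 0 < beta)
    (eta : 'rV[R]_p) (heta : ks_param ks eta)
    (H : rkhs (ks_fun ks eta)) :
  (exists f, is_minimizer (objective n u y H beta) (feasible H chi) f) /\
  (forall alpha_bar : R,
     is_alpha_bar n u y (ks_fun ks eta) chi alpha_bar ->
     is_minimizer (objective n u y H beta) (feasible H chi)
       (candidate n u y (ks_fun ks eta) (Num.max alpha_bar beta))).
Proof.
have hk := ks_kernel heta; have [chi_gt0 _] := andP hchi.
set k := ks_fun ks eta in H hk *.
pose z (i : 'I_(n - m)) := regressor m u y (m + i.+1)%N.
pose w := targets m n y.
pose f := candidate n u y k.
have Hf l : rkhs_set H (f l) := ridge_in H z w l.
have feasE g : rkhs_set H g ->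
    feasible H chi g <-> m%:R * rkhs_dot H g g <= chi.
  move=> Hg; rewrite /feasible /= /rkhs_norm (sqr_dot_norm (rkhs_hilbert H)) //.
  by split=> [[]|].
(* The unconstrained minimizer of the objective is optimal as soon as it is feasible. *)
have min_beta : m%:R * rkhs_dot H (f beta) (f beta) <= chi ->
    is_minimizer (objective n u y H beta) (feasible H chi) (f beta).
  move=> hf; split=> [|g [Hg _]]; first exact/feasE.
  by rewrite !objectiveE //; exact: (ridge_min hk z w hbeta Hg).
have main alpha : is_alpha_bar n u y k chi alpha ->
    is_minimizer (objective n u y H beta) (feasible H chi)
      (f (Num.max alpha beta)).
  case=> [[a_gt0 /eqP]|[noroot ->]].
    rewrite (gammaE n u y H) // subr_eq0 => /eqP fa.
    case: (leP alpha beta) => [ab|ba].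
      apply: min_beta; rewrite -fa ler_wpM2l //.
      exact: (ridge_norm_anti hk H z w a_gt0 ab).
    split=> [|g [Hg gchi]]; first by apply/feasE; rewrite // fa.
    have {}gchi : m%:R * rkhs_dot H g g <= chi by apply/feasE.
    (* For m = 0 the root equation [fa] would read 0 = chi. *)
    have m_gt0 : 0 < m%:R :> R.
      rewrite lt0r ler0n andbT; apply: contraTneq chi_gt0 => m0.
      by rewrite -fa m0 mul0r ltxx.
    have gf : rkhs_dot H g g <= rkhs_dot H (f alpha) (f alpha).
      by rewrite -(ler_pM2l m_gt0) fa.
    have fmin : \sum_i (f alpha (z i) - w i 0) ^+ 2
                + alpha * rkhs_dot H (f alpha) (f alpha)
                <= \sum_i (g (z i) - w i 0) ^+ 2 + alpha * rkhs_dot H g g.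
      exact: (ridge_min hk z w a_gt0 Hg).
    (* Complementary slackness: passing from the weight alpha back to beta costs f_alpha no more
       than g. *)
    have : 0 <= (alpha - beta)
                * (rkhs_dot H (f alpha) (f alpha) - rkhs_dot H g g).
      by rewrite mulr_ge0 // subr_ge0 // ltW.
    rewrite !objectiveE //; move: fmin; rewrite /z /w; lra.
  rewrite max_r; last exact: ltW.
  apply: min_beta; rewrite leNgt; apply/negP => fb.
  have [a a_gt0 fa] := ridge_norm_root hk (ler0n R m) chi_gt0 hbeta fb.
  by apply: (noroot a a_gt0); rewrite (gammaE n u y H) // -fa subrr.
split=> //.
(* By excluded middle some [alpha_bar] always exists, so solvability follows from [main]. *)
have [[a [a_gt0 ga]]|noroot] :=
    pselect (exists a, 0 < a /\ gamma n u y k chi a = 0).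
  by exists (f (Num.max a beta)); apply: main; left.
exists (f (Num.max 0 beta)); apply: main; right; split=> // a a_gt0 ga.
by apply: noroot; exists a.
Qed.
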